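(* The homeomorphisms $\mathbf J_{\partial\mathcal F}$ and $L$ of $\partial_I\mathcal F$ satisfy $\mathbf J_{\partial\mathcal F}L=L\mathbf J_{\partial\mathcal F}$. Hence for every irrational real $x$ one has $\mathbf J_{\mathbb R}\bigl(1-\tfrac1x\bigr)=1-\tfrac{1}{\mathbf J_{\mathbb R}(x)}$ in $\widehat{\mathbb R}$.
   Context: $\mathrm{PSL}_2(\mathbb Z)=\langle S,L\mid S^2=L^3=1\rangle$, $S(z)=-1/z$, $L(z)=(z-1)/z$. The bipartite Farey tree $\mathcal F$ has edge set $\mathrm{PSL}_2(\mathbb Z)$ and vertices the left cosets $\{W,WS\}$, $\{W,WL,WL^2\}$, two distinct vertices being joined by an edge iff they intersect. $\partial_I\mathcal F$ is the set of infinite non-backtracking paths in $\mathcal F$ starting at the identity edge $I$, i.e. infinite reduced words in $S,L,L^2$, with topology generated by the sets of paths through a given edge. Writing $0$ for $LS$ and $1$ for $L^2S$, these are the words $a$ or $Sa$ with $a\in\{0,1\}^\omega$. The action of $L$ on $\partial_I\mathcal F$ by left multiplication is $L(Sa)=0a$, $L(0a)=1a$, $L(1a)=Sa$. With $\phi=(01)^\omega$, $\phi^*=(10)^\omega$ and $\oplus$ term-wise exclusive or, $\mathbf J_{\partial\mathcal F}(a)=a\oplus\phi$ and $\mathbf J_{\partial\mathcal F}(Sa)=S(a\oplus\phi^* )$. $\widehat{\mathbb R}=\mathbb R\cup\{\infty\}$. For $a=0^{n_0}1^{n_1}0^{n_2}\cdots$ ($n_0\ge0$, $n_i\ge1$ for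 $i\ge1$; last exponent $\infty$ if eventually constant) let $\kappa(a)=[n_0,n_1,n_2,\dots]$ (continued fraction, $1/\infty=0$, $[\infty]=\infty$) and $\kappa(Sa)=-1/\kappa(a)$ (with $1/0=\infty$). Every irrational $x$ is $\kappa(w)$ for a unique $w\in\partial_I\mathcal F$, and $\mathbf J_{\mathbb R}:\mathbb R\setminus\mathbb Q\to\widehat{\mathbb R}$ is $\mathbf J_{\mathbb R}(x)=\kappa(\mathbf J_{\partial\mathcal F}(w))$. Conventions $1/0=\infty$, $1/\infty=0$, $1-\infty=\infty$. *)

(* Defs.v *)
From HB Require Import structures.
From mathcomp Require Import all_boot all_order all_algebra.
From mathcomp Require Import generic_quotient.
From mathcomp Require Import all_classical all_reals all_analysis.
Import Order.TTheory GRing.Theory Num.Theory.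
Import numFieldNormedType.Exports.

Set Implicit Arguments.
Unset Strict Implicit.
Unset Printing Implicit Defensive.

Local Open Scope classical_set_scope.
Local Open Scope ring_scope.
Local Open Scope quotient_scope.

Record SL2Z := SL2 { slval : 'M[int]_2; _ : \det slval == 1 }.
HB.instance Definition _ := [isSub for slval].
HB.instance Definition _ := [Choice of SL2Z by <:].

Definition sl_one : SL2Z := SL2 (introT eqP (det1 _ 2)).

Fact sl_mul_subproof (A B : SL2Z) : \det (val A *m val B) == 1.
Proof. by rewrite det_mulmx (eqP (valP A)) (eqP (valP B)) mul1r. Qed.
Definition sl_mul (A B : SL2Z) : SL2Z := SL2 (sl_mul_subproof A B).

Fact sl_inv_subproof (A : SL2Z) : \det (\adj (val A)) == 1.
Proof.
have := congr1 determinant (mul_mx_adj (val A)).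
by rewrite det_mulmx (eqP (valP A)) mul1r det1 => ->.
Qed.
Definition sl_inv (A : SL2Z) : SL2Z := SL2 (sl_inv_subproof A).

Definition sl_pm (A B : SL2Z) : bool :=
  (val A == val B) || (val A == - val B).

Fact sl_pm_equiv : equiv_class_of sl_pm.
Proof.
split=> [A|A B|B A C]; rewrite /sl_pm ?eqxx//.
  by rewrite eq_sym; congr orb; rewrite -eqr_oppLR eq_sym.
by move=> /orP[]/eqP-> /orP[]/eqP->; rewrite ?opprK ?eqxx ?orbT.
Qed.

Canonical sl_pm_rel := EquivRelPack sl_pm_equiv.

Definition PSL2Z := {eq_quot sl_pm}.
HB.instance Definition _ := Choice.on PSL2Z.

Definition psl_one : PSL2Z := \pi_PSL2Z sl_one.
Definition psl_mul (x y : PSL2Z) : PSL2Z := \pi_PSL2Z (sl_mul (repr x) (repr y)).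
Definition psl_inv (x : PSL2Z) : PSL2Z := \pi_PSL2Z (sl_inv (repr x)).

Lemma psl_piP (A B : SL2Z) :
  reflect (val A = val B \/ val A = - val B) (\pi_PSL2Z A == \pi_PSL2Z B).
Proof.
rewrite eqmodE /sl_pm_rel/= /sl_pm.
by apply: (iffP orP) => -[]/eqP; auto.
Qed.

Lemma psl_mul_pi (A B : SL2Z) :
  psl_mul (\pi_PSL2Z A) (\pi_PSL2Z B) = \pi_PSL2Z (sl_mul A B).
Proof.
apply/eqP/psl_piP => /=.
have /psl_piP/= : \pi_PSL2Z (repr (\pi_PSL2Z A)) == \pi_PSL2Z A by rewrite reprK.
have /psl_piP/= : \pi_PSL2Z (repr (\pi_PSL2Z B)) == \pi_PSL2Z B by rewrite reprK.
by case=> -> [] ->; rewrite ?mulNmx ?mulmxN ?opprK; auto.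
Qed.

Fact psl_mulA : associative psl_mul.
Proof.
elim/quotW => A; elim/quotW => B; elim/quotW => C.
rewrite (psl_mul_pi B) (psl_mul_pi A B) !psl_mul_pi.
by apply/eqP/psl_piP; left; rewrite /= mulmxA.
Qed.

Fact psl_mul1x : left_id psl_one psl_mul.
Proof.
elim/quotW => A; rewrite psl_mul_pi.
by apply/eqP/psl_piP; left; rewrite /= mul1mx.
Qed.

Fact psl_mulx1 : right_id psl_one psl_mul.
Proof.
elim/quotW => A; rewrite psl_mul_pi.
by apply/eqP/psl_piP; left; rewrite /= mulmx1.
Qed.

Fact psl_mulVx : left_inverse psl_one psl_inv psl_mul.
Proof.
move=> x; rewrite -[X in psl_mul _ X]reprK [LHS]psl_mul_pi.
apply/eqP/psl_piP; left.
by rewrite /= mul_adj_mx (eqP (valP (repr x))).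
Qed.

Fact psl_mulxV : right_inverse psl_one psl_inv psl_mul.
Proof.
move=> x; rewrite -[X in psl_mul X _]reprK [LHS]psl_mul_pi.
apply/eqP/psl_piP; left.
by rewrite /= mul_mx_adj (eqP (valP (repr x))).
Qed.

HB.instance Definition _ := isGroup.Build PSL2Z
  psl_mulA psl_mul1x psl_mulx1 psl_mulVx psl_mulxV.
HB.instance Definition _ := isPointed.Build PSL2Z psl_one.

Definition mx2 (a b c d : int) : 'M[int]_2 :=
  \matrix_(i, j) (if i == 0 then if j == 0 then a else b
                  else if j == 0 then c else d).

Lemma det_mx2 a b c d : \det (mx2 a b c d) = a * d - b * c.
Proof.
rewrite (expand_det_row _ ord0) !big_ord_recl big_ord0 /cofactor !det_mx11.
by rewrite !mxE /= expr0 expr1 mul1r mulN1r mulrN addr0.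
Qed.

Fact genS_subproof : \det (mx2 0 (-1) 1 0) == 1. Proof. by rewrite det_mx2. Qed.
Fact genL_subproof : \det (mx2 1 (-1) 1 0) == 1. Proof. by rewrite det_mx2. Qed.
(* The Moebius transformations z |-> -1/z and z |-> (z - 1)/z. *)
Definition genS : PSL2Z := \pi_PSL2Z (SL2 genS_subproof).
Definition genL : PSL2Z := \pi_PSL2Z (SL2 genL_subproof).

Lemma mulmx2 a b c d a' b' c' d' : mx2 a b c d *m mx2 a' b' c' d' =
  mx2 (a * a' + b * c') (a * b' + b * d') (c * a' + d * c') (c * b' + d * d').
Proof.
apply/matrixP => i j; rewrite !mxE !big_ord_recl big_ord0 !mxE /= addr0.
by case: i j => -[|[]]// ? [[|[]]].
Qed.

Lemma genS2 : (genS * genS)%g = 1%g.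
Proof.
rewrite [LHS]psl_mul_pi; apply/eqP/psl_piP; right => /=.
by rewrite mulmx2; apply/matrixP => -[[|[]]// ?] [[|[]]// ?]; rewrite !mxE.
Qed.

Lemma genL3 : (genL * genL * genL)%g = 1%g.
Proof.
rewrite [X in (X * _)%g]psl_mul_pi [LHS]psl_mul_pi.
apply/eqP/psl_piP; right => /=.
by rewrite !mulmx2; apply/matrixP => -[[|[]]// ?] [[|[]]// ?]; rewrite !mxE.
Qed.

Definition farey_vertex (V : set PSL2Z) : Prop :=
  exists W : PSL2Z, V = [set W; W * genS]%g \/
                    V = [set W; W * genL; W * (genL * genL)]%g.

(* An edge W joins the two vertices that contain it.  The sequence of edges    *)
(* e 0, e 1, ... of an infinite non-backtracking path v 0, v 1, ... of         *)
(* vertices whose first edge is the identity.                                  *)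
Definition path_from_id (e : nat -> PSL2Z) : Prop :=
  exists v : nat -> set PSL2Z, e 0 = 1%g /\
    forall n, [/\ farey_vertex (v n), v n <> v n.+1,
                  v n (e n), v n.+1 (e n) & v n <> v n.+2].

Inductive letter := letS | letL | letLL.

Definition letter_val (l : letter) : PSL2Z :=
  match l with
  | letS => genS
  | letL => genL
  | letLL => (genL * genL)%g
  end.

Definition isS (l : letter) : bool := if l is letS then true else false.

Definition reduced (w : nat -> letter) : Prop :=
  forall n, isS (w n.+1) = ~~ isS (w n).

(* The boundary of the Farey tree based at the identity edge, as the infinite  *)
(* reduced words; see path_from_idP and edge_inj.                              *)
Record boundary := Boundary { word :> nat -> letter; wordP : reduced word }.

Lemma boundary_eq (w w' : boundary) : word w =1 word w' -> w = w'.
Proof.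
case: w w' => [w wP] [w' w'P] /= /funext ww'.
by case: w' / ww' in w'P *; congr Boundary; exact: Prop_irrelevance.
Qed.

HB.instance Definition _ := gen_eqMixin boundary.
HB.instance Definition _ := gen_choiceMixin boundary.

(* The n-th edge of the path spelled by w. *)
Definition edge (w : boundary) (n : nat) : PSL2Z :=
  (\prod_(i < n) letter_val (w i))%g.

Lemma letter_val_neq :
  [/\ genS <> 1%g, genL <> 1%g, (genL * genL)%g <> 1%g, genL <> genS
    & (genL * genL)%g <> genS].
Proof.
have E : (genL * genL)%g =
    \pi_PSL2Z (sl_mul (SL2 genL_subproof) (SL2 genL_subproof)).
  exact: psl_mul_pi.
rewrite E; split=> /eqP/psl_piP/=; rewrite ?mulmx2 => -[] /matrixP H;
  have := H ord0 ord0; have := H ord0 ord_max; have := H ord_max ord_max;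
  by rewrite !mxE.
Qed.

Definition vertexS (W : PSL2Z) : set PSL2Z := [set W; W * genS]%g.
Definition vertexL (W : PSL2Z) : set PSL2Z :=
  [set W; W * genL; W * (genL * genL)]%g.

Lemma vertexS_mul W : vertexS (W * genS)%g = vertexS W.
Proof. by rewrite /vertexS -mulgA genS2 mulg1 setUC. Qed.

Lemma vertexL_mul W : vertexL (W * genL)%g = vertexL W.
Proof.
have E : (W * genL * (genL * genL) = W)%g.
  by rewrite -[LHS]mulgA (mulgA genL) genL3 mulg1.
by rewrite /vertexL E -(mulgA W) [LHS]setUC setUA.
Qed.

Lemma vertexL_mul2 W : vertexL (W * (genL * genL))%g = vertexL W.
Proof. by rewrite mulgA !vertexL_mul. Qed.

Lemma vertexS_neqL W W' : vertexS W <> vertexL W'.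
Proof.
have [S1 L1 _ LS _] := letter_val_neq.
move=> E; have WW' : vertexL W' = vertexL W.
  have : vertexL W' W by rewrite -E; left.
  by case=> [[]|] ->; rewrite ?vertexL_mul ?vertexL_mul2.
have : vertexS W (W * genL)%g by rewrite E WW'; left; right.
by case=> [/=|/mulgI//]; rewrite -[X in _ = X](mulg1 W) => /mulgI.
Qed.

Lemma farey_vertexP V W : farey_vertex V -> V W ->
  V = vertexS W \/ V = vertexL W.
Proof.
case=> X [] -> => [[]|[[]|]] ->; [left|left|right|right|right] => //.
- by rewrite vertexS_mul.
- by rewrite vertexL_mul.
- by rewrite vertexL_mul2.
Qed.

Lemma edge0 w : edge w 0 = 1%g.
Proof. by rewrite /edge big_ord0. Qed.

Lemma edgeS w n : edge w n.+1 = (edge w n * letter_val (w n))%g.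
Proof. by rewrite /edge big_ord_recr. Qed.

Lemma path_from_idP (e : nat -> PSL2Z) :
  path_from_id e <-> exists w, e = edge w.
Proof.
have [S1 L1 LL1 LS LLS] := letter_val_neq.
have M1 (W g : PSL2Z) : (W * g)%g = W -> g = 1%g.
  by rewrite -[X in _ = X](mulg1 W) => /mulgI.
have vS l W : isS l -> vertexS (W * letter_val l)%g = vertexS W.
  by case: l => // _; exact: vertexS_mul.
have vL l W : isS l = false -> vertexL (W * letter_val l)%g = vertexL W.
  by case: l => // _; [exact: vertexL_mul|exact: vertexL_mul2].
split=> [[v [e0 ve]]|[w ->]]; last first.
  exists (fun n => if isS (w n) then vertexL (edge w n) else vertexS (edge w n)).
  split=> [|n]; first exact: edge0.
  have rw := wordP w; rewrite !rw !edgeS negbK.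
  case wn : (isS (w n)) => /=.
  - rewrite (vS (w n))// (vL (w n.+1)) ?rw ?wn//.
    split; [by exists (edge w n); right|by apply: nesym; exact: vertexS_neqL
      |by left; left|by left|].
    move=> /seteqP[_ /(_ (edge w n * letter_val (w n))%g)].
    case: (w n) wn => // _ -[|[]|]; first by left; left.
    + by move/M1.
    + by move/mulgI/esym.
    + by move/mulgI/esym.
  - rewrite (vL (w n))// (vS (w n.+1)) ?rw ?wn//.
    split; [by exists (edge w n); left|exact: vertexS_neqL
      |by left|by left; left|].
    move=> /seteqP[_ /(_ (edge w n * letter_val (w n))%g)].
    case: (w n) wn => // _ -[||].
    + by left.
    + by move/M1.
    + by move/mulgI.
    + by left.
    + by move/M1.
    + by move/mulgI.
pose t n : bool := `[< v n = vertexS (e n) >].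
have tP n : (v n = if t n then vertexS (e n) else vertexL (e n)) /\
    (v n.+1 = if t n then vertexL (e n) else vertexS (e n)).
  have [Vn nn1 vn vn1 _] := ve n; have [VSn _ _ _ _] := ve n.+1.
  rewrite /t; case: asboolP => [vSn|nvSn].
    split=> //; case: (farey_vertexP VSn vn1) => // E.
    by case: nn1; rewrite vSn E.
  case: (farey_vertexP Vn vn) => [//|vLn]; split=> //.
  case: (farey_vertexP VSn vn1) => // E.
  by case: nn1; rewrite vLn E.
have tS n : t n.+1 = ~~ t n.
  have [_ +] := tP n; have [+ _] := tP n.+1; move=> ->.
  case: (t n.+1); case: (t n) => //.
    by move/vertexS_neqL.
  by move/nesym: (@vertexS_neqL (e n) (e n.+1)).
have eN n : e n.+1 <> e n.
  move=> en; have [vn vn1] := tP n; have [_ vn2] := tP n.+1.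
  have [_ _ _ _] := ve n; apply.
  by rewrite vn vn2 tS en; case: (t n).
have eL n : {l | e n.+1 = (e n * letter_val l)%g & isS l = ~~ t n}.
  apply: cid2.
  have [_ _ vn1 _ _] := ve n.+1; move: vn1; have [_ ->] := tP n.
  case: (t n) => /=.
    by case=> [[/eN//|]|] ->; [exists letL|exists letLL].
  by case=> [/eN//|] ->; exists letS.
pose w n := s2val (eL n).
have rw : reduced w.
  by move=> n; rewrite /w; case: (eL n) => l _ /= ->; case: (eL n.+1) => l' _ /= ->; rewrite tS.
exists (Boundary rw); apply/funext; elim=> [|n IHn]; first by rewrite edge0.
by rewrite edgeS -IHn /= /w; case: (eL n).
Qed.

Lemma edge_inj : injective edge.
Proof.
have [S1 L1 LL1 LS LLS] := letter_val_neq.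
move=> w w' ww'; apply: boundary_eq => n.
have := congr1 (fun e => e n.+1) ww'; rewrite /= !edgeS ww' => /mulgI.
have LLL : (genL * genL)%g <> genL.
  by rewrite -[X in _ = X](mulg1 genL) => /mulgI.
by case: (word w n) (word w' n) => -[] //= /esym.
Qed.

Definition through (W : PSL2Z) : set boundary :=
  [set w | exists n, edge w n = W].

HB.instance Definition _ :=
  isSubBaseTopological.Build boundary [set: PSL2Z] through.

(* The digits 0 = LS and 1 = L^2 S are encoded as false and true. *)
Definition digit_letter (d : bool) : letter := if d then letLL else letL.

Definition digit_word (a : nat -> bool) (n : nat) : letter :=
  if odd n then letS else digit_letter (a n./2).

Definition tail_seq (T : Type) (u : nat -> T) (n : nat) : T := u n.+1.
Definition cons_seq (T : Type) (x : T) (u : nat -> T) (n : nat) : T :=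
  if n is m.+1 then u m else x.

Fact bits_subproof a : reduced (digit_word a).
Proof. by move=> n; rewrite /digit_word/=; case: (odd n) (a _) (a _) => -[] []. Qed.
(* The word a. *)
Definition bits (a : nat -> bool) : boundary := Boundary (bits_subproof a).

Fact Sbits_subproof a : reduced (cons_seq letS (digit_word a)).
Proof. by case=> [|n] /=; [rewrite /digit_word/=; case: (a 0)|exact: bits_subproof]. Qed.
(* The word S a. *)
Definition Sbits (a : nat -> bool) : boundary := Boundary (Sbits_subproof a).

HB.instance Definition _ := isPointed.Build boundary (bits (fun=> false)).

(* The digit sequence of a word of the form a. *)
Definition digits (w : nat -> letter) (n : nat) : bool :=
  if w n.*2 is letLL then true else false.

Lemma digit_wordK a : digits (digit_word a) = a.
Proof.
apply/funext => n; rewrite /digits /digit_word odd_double doubleK.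
by case: (a n).
Qed.

Lemma digits_wordK (w : nat -> letter) :
  reduced w -> isS (w 0) = false -> digit_word (digits w) = w.
Proof.
move=> rw w0; apply/funext => n.
have wn : isS (w n) = odd n by elim: n => [//|n IHn]; rewrite rw IHn.
rewrite /digit_word /digits; case: ifPn wn => [on|en].
  by case: (w n).
by rewrite even_halfK//; case: (w n).
Qed.

(* Every element of the boundary is a or S a for a unique binary sequence a. *)
Variant boundary_spec : boundary -> Type :=
  | BoundaryBits a : boundary_spec (bits a)
  | BoundarySbits a : boundary_spec (Sbits a).

Lemma boundaryP (w : boundary) : boundary_spec w.
Proof.
have rw := wordP w; case Sw0 : (isS (w 0)).
  suff -> : w = Sbits (digits (tail_seq w)) by constructor.
  apply: boundary_eq => -[|n] /=; first by case: (w 0) Sw0.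
  by rewrite digits_wordK// /tail_seq ?rw ?Sw0// => k; exact: rw.
suff -> : w = bits (digits w) by constructor.
by apply: boundary_eq => n /=; rewrite digits_wordK.
Qed.

(* Left multiplication by L, followed by reduction. *)
Definition L_word (w : nat -> letter) : nat -> letter :=
  match w 0 with
  | letS => cons_seq letL w
  | letL => cons_seq letLL (tail_seq w)
  | letLL => tail_seq w
  end.

Fact L_subproof (w : boundary) : reduced (L_word w).
Proof.
have rw := wordP w; rewrite /L_word; case w0 : (word w 0).
- by case=> [|n] /=; rewrite ?w0 ?rw.
- by case=> [|n] /=; rewrite /tail_seq rw ?w0.
- by move=> n; exact: rw.
Qed.
Definition L_boundary (w : boundary) : boundary := Boundary (L_subproof w).

Lemma L_boundaryE :
  [/\ forall a, L_boundary (Sbits a) = bits (cons_seq false a),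
      forall a, L_boundary (bits (cons_seq false a)) = bits (cons_seq true a)
    & forall a, L_boundary (bits (cons_seq true a)) = Sbits a].
Proof.
have E (d : bool) a n : digit_word (cons_seq d a) n.+2 = digit_word a n.
  by rewrite /digit_word/= negbK.
split=> a; apply: boundary_eq.
- by case=> [|[|n]] //; rewrite /= /L_word/= E.
- by case=> [|[|n]] //; rewrite /= /L_word/= /tail_seq !E.
- by case=> [|n] //; rewrite /= /L_word/= /tail_seq E.
Qed.

Definition phi (n : nat) : bool := odd n.
Definition phi_star (n : nat) : bool := ~~ odd n.
Definition xor_seq (a b : nat -> bool) (n : nat) : bool := a n (+) b n.

Definition J_boundary (w : boundary) : boundary :=
  if isS (w 0) then Sbits (xor_seq (digits (tail_seq w)) phi_star)
  else bits (xor_seq (digits w) phi).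

Lemma J_boundaryE :
  (forall a, J_boundary (bits a) = bits (xor_seq a phi)) /\
  (forall a, J_boundary (Sbits a) = Sbits (xor_seq a phi_star)).
Proof.
split=> a; rewrite /J_boundary/=.
  by rewrite digit_wordK /digit_word/=; case: (a 0).
by rewrite [digits _](digit_wordK a).
Qed.

Definition homeomorphism (T U : topologicalType) (f : T -> U) : Prop :=
  exists g : U -> T, [/\ cancel f g, cancel g f, continuous f & continuous g].

Section Rhat.
Variable R : realType.

(* The circle R u {oo}; None is the point at infinity. *)
Definition Rhat := one_point_compactification R.

Definition hatV (x : Rhat) : Rhat :=
  match x with
  | Some r => if r == 0 then None else Some r^-1
  | None => Some 0
  end.

Definition hatN (x : Rhat) : Rhat := omap -%R x.

(* r + x and r - x, with r + oo = r - oo = oo *)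
Definition hat_add (r : R) (x : Rhat) : Rhat := omap (fun y => r + y) x.
Definition hat_sub (r : R) (x : Rhat) : Rhat := omap (fun y => r - y) x.

(* [n_0, ..., n_k], where None stands for an exponent oo; the expansion stops  *)
(* at the first infinite exponent.                                             *)
Fixpoint cf_trunc (n : nat -> option nat) (k : nat) : Rhat :=
  match n 0, k with
  | None, _ => None
  | Some m, 0 => Some m%:R
  | Some m, k'.+1 => hat_add m%:R (hatV (cf_trunc (tail_seq n) k'))
  end.

Definition cf (n : nat -> option nat) : Rhat := lim (cf_trunc n @ \oo).

(* The length of the longest initial run of the digit b in a. *)
Definition run (b : bool) (a : nat -> bool) : option nat :=
  if pselect (exists m, a m != b) is left a_neq_b
  then Some (ex_minn a_neq_b) else None.

(* With a = 0^n_0 1^n_1 0^n_2 ..., a without its first i blocks; meaningful    *)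
(* only as long as these are finite.                                           *)
Fixpoint drop_blocks (a : nat -> bool) (i : nat) : nat -> bool :=
  if i is j.+1 then
    let a' := drop_blocks a j in
    if run (odd j) a' is Some m then fun k => a' (m + k)%N else a'
  else a.

Definition exponents (a : nat -> bool) (i : nat) : option nat :=
  run (odd i) (drop_blocks a i).

Definition kappa (w : boundary) : Rhat :=
  if isS (w 0) then hatN (hatV (cf (exponents (digits (tail_seq w)))))
  else cf (exponents (digits w)).

(* For irrational x there is exactly one w with kappa w = x. *)
Definition JR (x : R) : Rhat :=
  kappa (J_boundary (get [set w | kappa w = Some x])).

End Rhat.

(* Main.v *)
Require Import Defs.
From HB Require Import structures.
From mathcomp Require Import all_boot all_order all_algebra.
From mathcomp Require Import all_classical all_reals all_analysis.
From mathcomp Require Import generic_quotient finmap zify ring lra.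
Import Order.TTheory GRing.Theory Num.Theory.
Import numFieldNormedType.Exports.
Set Implicit Arguments.
Unset Strict Implicit.
Unset Printing Implicit Defensive.
Local Open Scope ring_scope.

(** On infinite words the operators J and L are explicit: L permutes cyclically
    the three ways Sa, 0a, 1a in which a word can start, and J flips every
    other digit, with opposite phases for a and for Sa.  Passing from Sa to 0a,
    or from 1a to Sa, moves every digit of a by one place, which is exactly
    what the change of phase compensates; passing from 0a to 1a moves nothing.
    So J and L commute ([J_L_commute]).  As J^2 = L^3 = 1, both are
    homeomorphisms as soon as they are continuous, and they are because a prefix
    of the image is determined by a prefix of the argument.  That this is
    continuity for the topology generated by the sets of paths through an edge
    requires that these sets be the sets of words with a given prefix, that is,
    that reduced words in S and L spell distinct elements of PSL2(Z).  This is
    a ping-pong argument on the columns of matrices ([sector_letter],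
    [edge_prefix], [nbhs_cylinder]).

    For the statement on the real line, kappa conjugates L to z |-> 1 - 1/z on
    the whole boundary ([kappa_L]) and is a bijection above the irrationals
    ([kappa_inj], [kappa_surj]).  So if w spells x then Lw spells 1 - 1/x,
    and J_R(1 - 1/x) = kappa(J L w) = kappa(L J w) = 1 - 1/kappa(J w).

    The facts on kappa all come from one functional equation ([cf_cons]):
    prefixing a digit acts by z |-> 1 + z for 0 and by z |-> 1/(1 + 1/z) for 1.
    Up to a bounded shift of indices it already holds for the finite
    truncations of the continued fraction.  Hence truncations that are late
    enough lie in the image of [0, oo] under the first n digits, which is an
    interval of length 1/(r t) for a Moebius matrix with lower row (r, t).  As
    soon as a digit 1 has occurred, r t grows by at least 1 with each digit
    ([digits_interval]), so the truncations converge, the equation passes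
    to the limit, and a number is determined by its digits.  Conversely the
    equation shows that an irrational x > 0 dictates the digits of any word
    that spells it, by iterating x |-> x - 1 or x / (1 - x). *)

(** * The sets of paths through an edge are the cylinder sets *)

Local Open Scope quotient_scope.

(** The column (x, y) stands for the point x / y of the projective line; the
    arcs are [-oo, 0], [1, oo] and [0, 1]. *)
Definition column_in (l : letter) (x y : int) : bool :=
  match l with
  | letS => x * y <= 0
  | letL => (0 <= x * y) && (y * y <= x * x)
  | letLL => (0 <= x * y) && (x * x <= y * y)
  end.

Definition columns_in (l : letter) (A : 'M[int]_2) : bool :=
  column_in l (A 0 0) (A 1 0) && column_in l (A 0 1) (A 1 1).

(** The classes of the elements whose reduced word starts with a given letter:
    the edge of the Farey tessellation from g(oo) to g(0) lies above the arc
    attached to that letter.  The identity and S give the same edge, and this is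
    why the identity has to be excluded separately. *)
Definition sector (l : letter) (g : PSL2Z) : Prop :=
  g <> 1%g /\ exists2 A : SL2Z, g = \pi_PSL2Z A & columns_in l (val A).

Lemma det_SL2Z (A : SL2Z) :
  val A 0 0 * val A 1 1 - val A 0 1 * val A 1 0 = 1.
Proof.
have := eqP (valP A); rewrite (expand_det_row _ ord0) !big_ord_recl big_ord0.
rewrite /cofactor !det_mx11 !mxE /= expr0 expr1 mul1r mulN1r mulrN addr0 => <-.
by congr (val A _ _ * val A _ _ - val A _ _ * val A _ _); apply/val_inj.
Qed.

Lemma columns_inN l A : columns_in l (- A) = columns_in l A.
Proof. by rewrite /columns_in !mxE; case: l; rewrite /= !mulrNN. Qed.

Lemma sqr_eq_ge0 (x y : int) : 0 <= x * y -> x * x = y * y -> x = y.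
Proof.
move=> xy /eqP; rewrite -!expr2 eqf_sqr => /orP[/eqP//|/eqP xNy].
move: xy; rewrite {}xNy mulNr oppr_ge0 -expr2 => y2.
have /eqP : y ^+ 2 = 0 by apply/le_anti; rewrite y2 sqr_ge0.
by rewrite sqrf_eq0 => /eqP ->; rewrite oppr0.
Qed.

(** Two of the arcs only share an endpoint, and the columns of an invertible
    matrix are not proportional, so they cannot both be that endpoint. *)
Lemma columns_in_inj l l' (A : SL2Z) :
  columns_in l (val A) -> columns_in l' (val A) -> l = l'.
Proof.
move: (det_SL2Z A); rewrite /columns_in.
set a := val A 0 0; set b := val A 0 1; set c := val A 1 0; set d := val A 1 1.
move=> dA; clearbody a b c d.
have LLL : 0 <= a * c -> 0 <= b * d -> a * a = c * c -> b * b = d * d -> False.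
  move=> ac bd /(sqr_eq_ge0 ac) E /(sqr_eq_ge0 bd) F.
  by move: dA; rewrite E F; lia.
have SL : a * c <= 0 -> 0 <= a * c -> b * d <= 0 -> 0 <= b * d ->
    c * c <= a * a -> d * d <= b * b -> False.
  move=> ac ac' bd bd' ca db.
  have {ac ac'} ac : a * c = 0 by lia.
  have {bd bd'} bd : b * d = 0 by lia.
  have E : c = 0 by nia.
  have F : d = 0 by nia.
  by move: dA; rewrite E F; lia.
have SLL : a * c <= 0 -> 0 <= a * c -> b * d <= 0 -> 0 <= b * d ->
    a * a <= c * c -> b * b <= d * d -> False.
  move=> ac ac' bd bd' ca db.
  have {ac ac'} ac : a * c = 0 by lia.
  have {bd bd'} bd : b * d = 0 by lia.
  have E : a = 0 by nia.
  have F : b = 0 by nia.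
  by move: dA; rewrite E F; lia.
case: l; case: l' => //= /andP[h1 h2] /andP[h3 h4]; exfalso.
- case/andP: h3; case/andP: h4; auto.
- case/andP: h3; case/andP: h4; auto.
- case/andP: h1; case/andP: h2; auto.
- case/andP: h1; case/andP: h2; case/andP: h3; case/andP: h4 => *.
  by apply: LLL => //; lia.
- case/andP: h1; case/andP: h2; auto.
- case/andP: h1; case/andP: h2; case/andP: h3; case/andP: h4 => *.
  by apply: LLL => //; lia.
Qed.

Lemma mx2_eta (A : 'M[int]_2) : A = mx2 (A 0 0) (A 0 1) (A 1 0) (A 1 1).
Proof.
apply/matrixP => -[[|[|//]] i] [[|[|//]] j]; rewrite mxE /=.
all: by congr (A _ _); apply/val_inj.
Qed.

Lemma SL2Z_neq1 (A : SL2Z) :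
  val A 0 1 != 0 \/ val A 1 0 != 0 -> \pi_PSL2Z A <> psl_one.
Proof.
move=> bc /eqP/psl_piP A1.
by case: bc; case: A1 => ->; rewrite !mxE ?oppr0 ?eqxx.
Qed.

Lemma sector_inj l l' g : sector l g -> sector l' g -> l = l'.
Proof.
move=> [_ [A gA lA]] [_ [B gB lB]].
have /psl_piP AB : \pi_PSL2Z A == \pi_PSL2Z B by rewrite -gA gB.
apply: (@columns_in_inj l l' A) => //.
by case: AB => ->; rewrite ?columns_inN.
Qed.

Definition letter_mx (l : letter) : 'M[int]_2 :=
  match l with
  | letS => mx2 0 (-1) 1 0
  | letL => mx2 1 (-1) 1 0
  | letLL => mx2 0 (-1) 1 (-1)
  end.

Fact det_letter_mx l : \det (letter_mx l) == 1.
Proof. by case: l; rewrite det_mx2. Qed.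

Lemma letter_valE l : letter_val l = \pi_PSL2Z (SL2 (det_letter_mx l)).
Proof.
case: l => /=; try by apply/eqP/psl_piP; left.
rewrite [LHS]psl_mul_pi; apply/eqP/psl_piP; left.
by rewrite /= mulmx2.
Qed.

Lemma mul_letter_mx l a b c d : letter_mx l *m mx2 a b c d =
  match l with
  | letS => mx2 (- c) (- d) a b
  | letL => mx2 (a - c) (b - d) a b
  | letLL => mx2 (- c) (- d) (a - c) (b - d)
  end.
Proof. by case: l; rewrite mulmx2; congr mx2; lia. Qed.

(** Ping-pong: L and L^2 send [-oo, 0] to [1, oo] and [0, 1], and S exchanges
    [-oo, 0] and [0, oo]. *)
Lemma sector_letter l l' g : isS l = ~~ isS l' -> g = 1%g \/ sector l' g ->
  sector l (letter_val l * g)%g.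
Proof.
move=> ll' gl'.
have [A gA Agl'] : exists2 A : SL2Z, g = \pi_PSL2Z A &
    val A = 1%:M \/ columns_in l' (val A).
  case: gl' => [->|[_ [A gA lA]]]; first by exists sl_one => //; left.
  by exists A => //; right.
rewrite letter_valE gA [X in sector _ X]psl_mul_pi.
have dA := det_SL2Z A.
split; first apply: SL2Z_neq1 => /=.
  rewrite (mx2_eta (val A)) mul_letter_mx.
  case: Agl' => [->|].
    by case: l {ll'} => /=; rewrite !mxE /=; lia.
  rewrite /columns_in; move: dA.
  move: (val A 0 0) (val A 0 1) (val A 1 0) (val A 1 1) => a b c d dA.
  move=> ac; apply/orP; rewrite -negb_and; apply/negP => /andP[].
  case: l ll' => ll'; rewrite !mxE /= => /eqP b0 /eqP c0.
  + have {b0} b0 : d = 0 by lia.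
    move: ac dA; rewrite b0 c0; case: l' ll' {gl'} => //= _; nia.
  + have {b0} b0 : d = b by lia.
    by move: ac dA; rewrite b0 c0; case: l' ll' {gl'} => //= _; nia.
  + have {b0} b0 : d = 0 by lia.
    have {c0} c0 : c = a by lia.
    by move: ac dA; rewrite b0 c0; case: l' ll' {gl'} => //= _; nia.
eexists; first reflexivity.
rewrite /columns_in /= (mx2_eta (val A)) mul_letter_mx.
case: Agl' => [->|]; first by case: l {ll'}; rewrite !mxE.
rewrite /columns_in.
move: (val A 0 0) (val A 0 1) (val A 1 0) (val A 1 1) => a b c d.
case: l ll' => ll'; rewrite !mxE /= => ac.
- have {ac} : 0 <= a * c /\ 0 <= b * d.
    by case: l' ll' {gl'} ac => //= _; lia.
  by nia.
- case: l' ll' {gl'} ac => //= _; nia.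
- case: l' ll' {gl'} ac => //= _; nia.
Qed.

Fact tail_subproof (w : boundary) : reduced (tail_seq w).
Proof. by move=> n; exact: wordP. Qed.
Definition tail_boundary (w : boundary) : boundary := Boundary (tail_subproof w).

Lemma edge_recl (w : boundary) n :
  edge w n.+1 = (letter_val (w 0) * edge (tail_boundary w) n)%g.
Proof. by rewrite /edge big_ord_recl. Qed.

Lemma edge_sector (w : boundary) n : sector (w 0) (edge w n.+1).
Proof.
elim: n w => [|n IHn] w; rewrite edge_recl.
  by apply: (@sector_letter _ (w 1)); [rewrite (wordP w) negbK|left; exact: edge0].
by apply: (@sector_letter _ (w 1)); [rewrite (wordP w) negbK|right; exact: IHn].
Qed.

(** Uniqueness of reduced words in the free product of Z/2 and Z/3: the sector of
    an element reveals the first letter, which can then be cancelled. *)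
Lemma edge_prefix (w w' : boundary) m k :
  edge w' k = edge w m -> forall i, (i < m)%N -> w' i = w i.
Proof.
elim: m w w' k => [//|m IHm] w w' [|k].
  by rewrite edge0 => /esym; have [] := edge_sector w m.
move=> E; have E0 : w' 0 = w 0.
  by apply: (sector_inj (edge_sector w' k)); rewrite E; exact: edge_sector.
move: E; rewrite !edge_recl E0 => /mulgI /IHm {}IHm [//|i]; exact: IHm.
Qed.

Lemma open_through W : open (through W).
Proof.
exists [set through W]%classic; last by rewrite bigcup_set1.
by move=> _ ->; exact: finI_from1.
Qed.

Lemma nbhs_cylinder (w : boundary) n :
  nbhs w [set w' | forall i, (i < n)%N -> w' i = w i]%classic.
Proof.
apply: filterS (open_nbhs_nbhs (conj (@open_through (edge w n)) _)).
  by move=> w' [k]; exact: edge_prefix.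
by exists n.
Qed.

Lemma edge_eq (w w' : boundary) n :
  (forall i, (i < n)%N -> w' i = w i) -> edge w' n = edge w n.
Proof. by move=> ww'; apply: eq_bigr => i _; rewrite ww'. Qed.

(** Only finitely many letters of a word are needed to see that it goes through
    a given edge. *)
Lemma continuous_prefix (f : boundary -> boundary) :
  (forall (w : boundary) n, exists m, forall w' : boundary,
    (forall i, (i < m)%N -> w' i = w i) -> f w' n = f w n) ->
  continuous f.
Proof.
move=> fP w A; rewrite nbhsE => -[B [[D DS <-] [C DC Cfw]] BA].
have [E _ EC] := DS _ DC.
have cE i : i \in E -> nbhs w (f @^-1` (through i))%classic.
  move=> iE; move: Cfw; rewrite -EC => /(_ i iE) [n fwn].
  have : nbhs w [set w' | forall j : 'I_n, f w' j = f w j]%classic.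
    apply: (@filter_forall boundary 'I_n (fun j w' => f w' j = f w j) (nbhs w)
      (nbhs_filter w)) => j.
    by have [m fm] := fP w j; apply: filterS (nbhs_cylinder w m) => w' /fm.
  apply: filterS => w' ww'; exists n; rewrite -fwn; apply: edge_eq => k kn.
  exact: (ww' (Ordinal kn)).
apply: filterS (filter_bigI (nbhs_filter w) cE).
move=> w' w'E; apply: BA; exists C => //=; rewrite -EC => i iE; exact: w'E.
Qed.

(** * The commuting homeomorphisms J and L *)

Lemma digit_word_local (a b : nat -> bool) n :
  a n./2 = b n./2 -> digit_word a n = digit_word b n.
Proof. by rewrite /digit_word => ->. Qed.

Lemma J_boundary_continuous : continuous J_boundary.
Proof.
apply: continuous_prefix => w n; exists n.+1 => w' ww'.
rewrite /J_boundary ww'//; case: ifP => _.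
  case: n ww' => [//|n] ww' /=; apply: digit_word_local.
  rewrite /xor_seq /digits /tail_seq ww'//.
  by rewrite !ltnS -{2}(odd_double_half n) leq_addl.
apply: digit_word_local.
by rewrite /xor_seq /digits ww'// ltnS -{2}(odd_double_half n) leq_addl.
Qed.

Lemma L_boundary_continuous : continuous L_boundary.
Proof.
apply: continuous_prefix => w n; exists n.+2 => w' ww'.
rewrite /= /L_word ww'//; case: (word w 0); last by rewrite /tail_seq ww'.
  by case: n ww' => [//|n] ww' /=; rewrite ww'// ltnS ltnW.
by case: n ww' => [//|n] ww' /=; rewrite /tail_seq ww'.
Qed.

Lemma J_boundaryK : involutive J_boundary.
Proof.
have [Jb JS] := J_boundaryE.
have xorK p a : xor_seq (xor_seq a p) p = a.
  by apply/funext => n; rewrite /xor_seq -addbA addbb addbF.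
by move=> w; case: (boundaryP w) => a; rewrite ?(Jb, JS) xorK.
Qed.

Lemma cons_tail (T : Type) (u : nat -> T) : cons_seq (u 0) (tail_seq u) = u.
Proof. by apply/funext => -[]. Qed.

Variant boundary_head_spec : boundary -> Type :=
  | BoundaryHeadS a : boundary_head_spec (Sbits a)
  | BoundaryHead0 a : boundary_head_spec (bits (cons_seq false a))
  | BoundaryHead1 a : boundary_head_spec (bits (cons_seq true a)).

Lemma boundary_headP (w : boundary) : boundary_head_spec w.
Proof.
case: (boundaryP w) => a; last by constructor.
by rewrite -(cons_tail a); case: (a 0); constructor.
Qed.

Lemma L_boundary3 w : L_boundary (L_boundary (L_boundary w)) = w.
Proof.
have [LS L0 L1] := L_boundaryE.
by case: (boundary_headP w) => a; rewrite !(LS, L0, L1).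
Qed.

Lemma J_homeomorphism : homeomorphism J_boundary.
Proof.
by exists J_boundary; split; [exact: J_boundaryK|exact: J_boundaryK
  |exact: J_boundary_continuous|exact: J_boundary_continuous].
Qed.

Lemma L_homeomorphism : homeomorphism L_boundary.
Proof.
exists (L_boundary \o L_boundary); split=> [w|w||]; first exact: L_boundary3.
- exact: L_boundary3.
- exact: L_boundary_continuous.
- by move=> w; apply: continuous_comp; exact: L_boundary_continuous.
Qed.

Lemma J_L_commute w : J_boundary (L_boundary w) = L_boundary (J_boundary w).
Proof.
have [Jb JS] := J_boundaryE; have [LS L0 L1] := L_boundaryE.
(* Removing or adding one digit exchanges (01)^w and (10)^w. *)
have xor_cons d a :
    xor_seq (cons_seq d a) phi = cons_seq d (xor_seq a phi_star).
  by apply/funext => -[|n]; rewrite /xor_seq /= ?addbF.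
by case: (boundary_headP w) => a; rewrite !(LS, L0, L1, Jb, JS, xor_cons).
Qed.

(** * Exponents of a digit sequence *)

Variant run_spec (b : bool) (a : nat -> bool) : option nat -> Prop :=
  | RunFinite m of a m != b & (forall i, (i < m)%N -> a i = b) :
      run_spec b a (Some m)
  | RunInfinite of (forall i, a i = b) : run_spec b a None.

Lemma runP b a : run_spec b a (run b a).
Proof.
rewrite /run; case: pselect => [ab|nab]; last first.
  by constructor=> i; apply/eqP/negPn/negP => aib; apply: nab; exists i.
case: ex_minnP => m amb mP; constructor=> // i im.
by apply/eqP/negPn/negP => /mP; rewrite leqNgt im.
Qed.

Lemma run_finite b a m :
  a m != b -> (forall i, (i < m)%N -> a i = b) -> run b a = Some m.
Proof.
case: runP => [m' am' ltm' am ltm|aE]; last by rewrite aE eqxx.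
congr Some; case: (ltngtP m m') => // [/ltm' E|/ltm E].
  by rewrite E eqxx in am.
by rewrite E eqxx in am'.
Qed.

Lemma run_infinite b a : (forall i, a i = b) -> run b a = None.
Proof. by move=> aE; case: runP => // m; rewrite aE eqxx. Qed.

Lemma run_cons b a : run b (cons_seq b a) = omap succn (run b a).
Proof.
case: (runP b a) => [m am ltm|aE] /=; last by apply: run_infinite => -[|i] /=.
by apply: run_finite => // -[|i] //= /ltm.
Qed.

Lemma run0 b a : a 0 != b -> run b a = Some 0.
Proof. by move=> ab; apply: run_finite. Qed.

Definition neg_seq (a : nat -> bool) (n : nat) : bool := ~~ a n.

Lemma neg_seqK : involutive neg_seq.
Proof. by move=> a; apply/funext => n; rewrite /neg_seq negbK. Qed.

Lemma neg_cons d a : neg_seq (cons_seq d a) = cons_seq (~~ d) (neg_seq a).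
Proof. by apply/funext => -[]. Qed.

Lemma run_neg b a : run (~~ b) (neg_seq a) = run b a.
Proof.
case: (runP b a) => [m am ltm|aE]; last first.
  by apply: run_infinite => i; rewrite /neg_seq aE.
apply: run_finite => [|i im]; last by rewrite /neg_seq ltm.
by rewrite /neg_seq; case: (a m) b am {ltm} => -[].
Qed.

Lemma drop_blocksS (a : nat -> bool) i : drop_blocks a i.+1 =
  let a' := drop_blocks a i in
  if run (odd i) a' is Some m then fun k => a' (m + k)%N else a'.
Proof. by []. Qed.

Lemma drop_blocks_cons a i m : run false a = Some m ->
  drop_blocks (cons_seq false a) i.+1 = drop_blocks a i.+1.
Proof.
move=> am; elim: i => [|i IHi]; first by rewrite /= run_cons am.
by rewrite drop_blocksS IHi -drop_blocksS.
Qed.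

(** When a starts with the digit 1, its first block of 0s is empty, and
    exchanging the digits amounts to discarding that block. *)
Lemma drop_blocks_neg (a : nat -> bool) i : a 0 ->
  drop_blocks a i.+1 = neg_seq (drop_blocks (neg_seq a) i).
Proof.
move=> a0; elim: i => [|i IHi].
  by rewrite /= run0 ?a0//= neg_seqK.
rewrite drop_blocksS IHi /= run_neg.
by case: (run _ _).
Qed.

(** * Convergents and the action of the digits *)

Section Convergents.
Context {R : realType}.
Implicit Types (x : R) (y z : Rhat R) (a b : nat -> bool).

Definition convergent a k : Rhat R := cf_trunc R (exponents a) k.

Lemma cf_truncS n k : cf_trunc R n k.+1 =
  if n 0 is Some m then hat_add m%:R (hatV (cf_trunc R (tail_seq n) k)) else None.
Proof. by []. Qed.

Lemma hat_addA r s y : hat_add (r + s) y = hat_add r (hat_add s y) :> Rhat R.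
Proof. by case: y => //= t; rewrite addrA. Qed.

Lemma hat_add0 y : hat_add 0 y = y.
Proof. by case: y => //= t; rewrite add0r. Qed.

Lemma hatVK y : hatV (hatV y) = y.
Proof.
case: y => [r|] /=; last by rewrite eqxx.
by case: eqVneq => [->//|r0] /=; rewrite invr_eq0 (negbTE r0) invrK.
Qed.

(** A further leading 0 lengthens the first block by one and leaves the other
    blocks alone. *)
Lemma convergent_cons0 a k :
  convergent (cons_seq false a) k = hat_add 1 (convergent a k).
Proof.
rewrite /convergent; have := run_cons false a.
case am : (run false a) => [m|] /= rE; last first.
  have E n : n 0 = None -> cf_trunc R n k = None by case: k => /= [|k] ->.
  by rewrite !E// /exponents /=.
have E0 : exponents (cons_seq false a) 0 = Some m.+1 by [].
have E0' : exponents a 0 = Some m by [].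
case: k => [|k].
  by rewrite /= E0 E0' /= -natr1 addrC.
rewrite !cf_truncS E0 E0' -hat_addA nat1r.
congr (hat_add _ (hatV (cf_trunc R _ _))).
by apply/funext => i; rewrite /tail_seq /exponents (drop_blocks_cons _ am).
Qed.

(** With n_0 = 0 the continued fraction is the inverse of [n_1, n_2, ...], whose
    exponents are those of the exchanged digits. *)
Lemma convergent_neg a k : a 0 ->
  convergent a k.+1 = hatV (convergent (neg_seq a) k).
Proof.
move=> a0; rewrite /convergent cf_truncS.
have -> : exponents a 0 = Some 0 by rewrite /exponents /= run0 ?a0.
rewrite hat_add0; congr (hatV (cf_trunc R _ _)).
by apply/funext => i; rewrite /tail_seq /exponents drop_blocks_neg //= run_neg.
Qed.

(** The Moebius transformations LS and L^2 S.  The second one is z / (z + 1); it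
    is written with two inversions so as to have the right value at oo too. *)
Definition digit_map (d : bool) (y : Rhat R) : Rhat R :=
  if d then hatV (hat_add 1 (hatV y)) else hat_add 1 y.

(** The number of blocks changes by 0 or 2 according to the first digits, so
    that the index on the right depends on them, but only by a constant. *)
Lemma convergent_cons d a : exists p, forall k,
  convergent (cons_seq d a) k.+2 = digit_map d (convergent a (p + k)).
Proof.
case: d; last by exists 2%N => k; rewrite convergent_cons0.
case a0 : (a 0).
  exists 2%N => k; rewrite convergent_neg// neg_cons convergent_cons0.
  by rewrite -[(2 + k)%N]/k.+2 (convergent_neg k.+1 a0) /= hatVK.
exists 0%N => k; rewrite convergent_neg// neg_cons convergent_cons0.
by rewrite convergent_neg /neg_seq ?a0// -/(neg_seq _) neg_seqK.
Qed.

End Convergents.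

Arguments digit_map {R} d y : simpl never.

(** * Convergence of the continued fractions *)

Section KappaConvergence.
Local Open Scope classical_set_scope.
Local Open Scope ring_scope.
Context {R : realType}.
Implicit Types (x r s : R) (y z : Rhat R) (a b : nat -> bool).

Definition hat_ge0 y : bool := if y is Some r then 0 <= r else true.

Lemma hatV_ge0 y : hat_ge0 y -> hat_ge0 (hatV y).
Proof. by case: y => //= r r0; case: ifP => //= _; rewrite invr_ge0. Qed.

Lemma hat_add_ge0 r y : 0 <= r -> hat_ge0 y -> hat_ge0 (hat_add r y).
Proof. by case: y => //= s r0 s0; rewrite addr_ge0. Qed.

Lemma cf_trunc_ge0 n k : hat_ge0 (cf_trunc R n k).
Proof.
elim: k n => [|k IHk] n /=; case: (n 0) => //= m.
by rewrite hat_add_ge0// hatV_ge0.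
Qed.

Lemma digit_map_ge0 d y : hat_ge0 y -> hat_ge0 (digit_map d y).
Proof.
by case: d => y0; rewrite /digit_map ?hatV_ge0// hat_add_ge0// hatV_ge0.
Qed.

Lemma hatV_some r : r != 0 -> hatV (Some r) = Some r^-1.
Proof. by move=> /negbTE /= ->. Qed.

Lemma digit_map_some d r : 0 <= r ->
  digit_map d (Some r) = Some (if d then r / (1 + r) else 1 + r).
Proof.
case: d => // r0; rewrite /digit_map.
have [->|rn0] := eqVneq r 0; first by rewrite /= ?eqxx mul0r.
have rp : 0 < r by rewrite lt_neqAle eq_sym rn0.
have r1 : 1 + r^-1 != 0 by rewrite lt0r_neq0// addr_gt0// invr_gt0.
rewrite hatV_some// [hat_add _ _]/= hatV_some//; congr Some.
by field; rewrite gt_eqF ?addr_gt0.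
Qed.

Lemma digit_map_none d : digit_map d None = (if d then Some 1 else None) :> Rhat R.
Proof. by case: d; rewrite /digit_map //= addr0 oner_eq0 invr1. Qed.

Fixpoint digits_map a n y : Rhat R :=
  if n is m.+1 then digits_map a m (digit_map (a m) y) else y.

Definition moebius (p q r t : R) y : Rhat R :=
  match y with
  | Some x => Some ((p * x + q) / (r * x + t))
  | None => if r == 0 then None else Some (p / r)
  end.

(** The matrix (p, q; r, t) is the product of the matrices of the digits.  A digit
    1 adds the second column to the first and a digit 0 the first to the second,
    so t >= 1 always holds, r >= 1 holds after the first digit 1, and
    from then on each step increases r t by t^2 or r^2. *)
Lemma digits_map_moebius a n : exists p q r t : R,
  [/\ p * t - q * r = 1, [/\ 1 <= p, 0 <= q, 0 <= r & 1 <= t],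
      forall m, (m < n)%N -> a m -> 1 <= r /\ (n - m)%:R <= r * t
    & forall y, hat_ge0 y -> digits_map a n y = moebius p q r t y].
Proof.
elim: n => [|n [p [q [r [t [dt [p1 q0 r0 t1] rt M]]]]]].
  exists 1, 0, 0, 1; split=> //; first by rewrite mulr1 mul0r subr0.
  by case=> [x|] _ /=; rewrite ?eqxx// mul1r addr0 mul0r add0r divr1.
have rt0 x : 0 <= x -> 0 < r * x + t by nra.
have nm m : (m < n)%N -> (n.+1 - m)%:R = (n - m)%:R + 1 :> R.
  by move=> mn; rewrite subSn ?natr1// ltnW.
case an : (a n).
- exists (p + q), q, (r + t), t; split; first by rewrite -dt; ring.
  + by split=> //; lra.
  + move=> m; rewrite ltnS leq_eqVlt => /predU1P[-> _|mn am].
      by rewrite subSnn; split; nra.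
    by have [r1 rtn] := rt m mn am; rewrite nm//; split; nra.
  + move=> y y0 /=; rewrite an M ?digit_map_ge0//.
    case: y y0 => [x|] /= y0; last first.
      rewrite digit_map_none /= gt_eqF; last by lra.
      by rewrite !mulr1.
    rewrite digit_map_some//=; congr Some.
    by field; rewrite !lt0r_neq0//; nra.
- exists p, (p + q), r, (r + t); split; first by rewrite -dt; ring.
  + by split=> //; lra.
  + move=> m; rewrite ltnS leq_eqVlt => /predU1P[->|mn am]; first by rewrite an.
    by have [r1 rtn] := rt m mn am; rewrite nm//; split; nra.
  + move=> y y0 /=; rewrite an M ?digit_map_ge0//.
    case: y y0 => [x|] //= y0; congr (Some (_ / _)); ring.
Qed.

(** The image of [0, oo] is [q / t, p / r], of length 1 / (r t) because the
    determinant is 1. *)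
Lemma digits_interval a m n : (m < n)%N -> a m -> exists2 lo : R, 0 <= lo &
  forall y, hat_ge0 y -> exists2 x, digits_map a n y = Some x &
    lo <= x <= lo + (n - m)%:R^-1.
Proof.
move=> mn am.
have [p [q [r [t [dt [p1 q0 r0 t1] + M]]]]] := digits_map_moebius a n.
move=> /(_ m mn am)[r1 rtn].
have t0 : 0 < t by lra.
have rp : 0 < r by lra.
have rt0 : 0 < r * t by exact: mulr_gt0.
have nm0 : 0 < (n - m)%:R :> R by rewrite ltr0n subn_gt0.
exists (q / t); first by rewrite divr_ge0// ltW.
move=> y y0; rewrite M//.
suff [x -> /andP[x0 x1]] : exists2 x, moebius p q r t y = Some x &
    0 <= x - q / t <= (r * t)^-1.
  exists x => //; rewrite -subr_ge0 x0 /= -lerBlDl (le_trans x1)//.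
  by rewrite lef_pV2 ?posrE.
case: y y0 => [z|] /= z0; last first.
  rewrite gt_eqF//; exists (p / r) => //.
  have -> : p / r - q / t = (p * t - q * r) / (r * t).
    by field; rewrite !gt_eqF.
  by rewrite dt mul1r lexx invr_ge0 ltW.
have h : 0 < r * z + t by nra.
eexists; first reflexivity.
have -> : (p * z + q) / (r * z + t) - q / t =
    (p * t - q * r) * z / (t * (r * z + t)).
  by field; rewrite !gt_eqF.
rewrite dt mul1r divr_ge0 ?mulr_ge0 ?(ltW h) ?(ltW t0)//=.
rewrite ler_pdivrMr ?mulr_gt0// mulrC ler_pdivlMr//.
nra.
Qed.

Definition drop_seq n a : nat -> bool := fun i => a (n + i)%N.

Lemma drop_seqE n a : drop_seq n a = cons_seq (a n) (drop_seq n.+1 a).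
Proof.
by apply/funext => -[|i]; rewrite /drop_seq /= ?addn0// addSnnS.
Qed.

(** Reading a digit costs at most two levels of the continued fraction. *)
Lemma convergent_digits a n k : exists2 k', (k <= k')%N &
  convergent a (n.*2 + k) = digits_map a n (convergent (drop_seq n a) k') :> Rhat R.
Proof.
elim: n k => [|n IHn] k; first by exists k.
rewrite doubleS -[in X in convergent _ X]addn2 -addnA.
have [[|[|k']]// kk' ->] := IHn (2 + k)%N.
have [p pE] := @convergent_cons R (a n) (drop_seq n.+1 a).
exists (p + k')%N; first exact: (@leq_trans k' k _ kk' (leq_addl _ _)).
by rewrite drop_seqE pE.
Qed.

Lemma Rhat_hausdorff : hausdorff_space (Rhat R).
Proof.
exact: one_point_compactification_hausdorff (@locally_compactR R) (@Rhausdorff R).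
Qed.

(** The shift c absorbs the change of index in [convergent_cons]. *)
Lemma cf_lim a c (v : nat -> R) s :
  (\forall k \near \oo, convergent a (k + c) = Some (v k)) ->
  (v @ \oo --> s) -> cf R (exponents a) = Some s.
Proof.
move=> av vs; apply: (cvg_lim Rhat_hausdorff).
rewrite -(cvg_shiftn c).
have : (Some \o v @ \oo --> (Some s : Rhat R)).
  apply: (cvg_comp v Some vs).
  exact: one_point_compactification_some_continuous.
apply: cvg_trans; apply: near_eq_cvg.
by apply: filterS av => k; rewrite /convergent /= => ->.
Qed.

Lemma convergent_infinite a k : (forall i, a i = false) ->
  convergent a k = None :> Rhat R.
Proof.
move=> a0; rewrite /convergent; have : exponents a 0 = None.
  by rewrite /exponents /= run_infinite.
by case: k => /= [|k] ->.
Qed.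

Lemma cf_infinite a : (forall i, a i = false) ->
  cf R (exponents a) = None.
Proof.
move=> a0; apply: (lim_near_cst Rhat_hausdorff).
by apply: nearW => k; exact: convergent_infinite.
Qed.

(** From level 2n on, the convergents stay in one interval of length
    1 / (n - m), which makes them a Cauchy sequence of reals. *)
Lemma convergent_cvg a m : a m -> exists r (v : nat -> R),
  [/\ 0 <= r, v @ \oo --> r &
    forall k, (m.+1.*2 <= k)%N -> convergent a k = Some (v k)].
Proof.
move=> am; pose v k := odflt 0 (convergent a k : option R).
have vP n : (m < n)%N -> exists2 lo : R, 0 <= lo & forall k, (n.*2 <= k)%N ->
    convergent a k = Some (v k) /\ lo <= v k <= lo + (n - m)%:R^-1.
  move=> mn; have [lo lo0 loP] := digits_interval mn am.
  exists lo => // k nk; rewrite /v -(subnKC nk).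
  have [k' _ ->] := convergent_digits a n (k - n.*2).
  by have [x -> xlo] := loP (convergent (drop_seq n a) k') (cf_trunc_ge0 _ _).
have : cvg (v @ \oo).
  apply/cauchy_cvgP; apply: cauchy_exP => e e0.
  have [N _ Ne] := near_infty_natSinv_lt (PosNum e0).
  have [lo _ loP] := vP (m + N.+1)%N ltac:(by rewrite addnS ltnS leq_addr).
  exists lo; exists (m + N.+1).*2 => // k /= /loP[_ /andP[lov vlo]].
  rewrite /ball /= distrC ger0_norm ?subr_ge0// ltrBlDl (le_lt_trans vlo)//.
  by rewrite ltrD2l addKn; exact: (Ne N (leqnn N)).
move=> cv; exists (lim (v @ \oo)), v; have [lo lo0 loP] := vP m.+1 (ltnSn m).
split=> //; last by move=> k /loP[].
apply: limr_ge => //; exists m.+1.*2 => // k /= /loP[_ /andP[+ _]].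
exact: le_trans.
Qed.

(** If a has a digit 1, the maps of the digits are continuous at the finite limit
    of its convergents; otherwise all convergents are oo and the claim is an
    evaluation at oo. *)
Lemma cf_cons d a :
  cf R (exponents (cons_seq d a)) = digit_map d (cf R (exponents a)).
Proof.
have [p pE] := @convergent_cons R d a.
have [[m am]|a0] := pselect (exists m, a m); last first.
  have {}a0 i : a i = false by apply/negP => ai; apply: a0; exists i.
  rewrite (cf_infinite a0) digit_map_none.
  case: d pE => pE; last by apply: cf_infinite => -[|i] /=.
  apply: (@cf_lim _ 2 (cst 1)); last exact: cvg_cst.
  apply: nearW => k; rewrite addn2 pE convergent_infinite//.
  by rewrite digit_map_none.
have [r [v [r0 vr vE]]] := convergent_cvg am.
have vge0 k : (m.+1.*2 <= k)%N -> 0 <= v k.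
  move=> /vE vk; have := @cf_trunc_ge0 (exponents a) k.
  by rewrite -/(convergent a k) vk.
have -> : cf R (exponents a) = Some r.
  apply: (@cf_lim _ 0 v) => //; exists m.+1.*2 => // k /= mk.
  by rewrite addn0 vE.
rewrite digit_map_some//.
pose g x := if d then x / (1 + x) else 1 + x.
apply: (@cf_lim _ 2 (fun k => g (v (p + k)%N))).
  exists m.+1.*2 => // k /= mk; have mpk := leq_trans mk (leq_addl p k).
  by rewrite addn2 pE vE// digit_map_some// vge0.
have vp : v (p + k)%N @[k --> \oo] --> r.
  under eq_fun do rewrite addnC; exact: cvg_comp (cvg_addnr p) vr.
have vp1 : 1 + v (p + k)%N @[k --> \oo] --> 1 + r.
  by apply: cvgD => //; exact: cvg_cst.
rewrite {}/g; case: d {pE} => //.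
by apply: cvgM => //; apply: cvgV => //; rewrite gt_eqF// ltr_pwDl.
Qed.

Lemma cf_ge0 a : hat_ge0 (cf R (exponents a)).
Proof.
have [[m am]|a0] := pselect (exists m, a m); last first.
  by rewrite cf_infinite// => i; apply/negP => ai; apply: a0; exists i.
have [r [v [r0 vr vE]]] := convergent_cvg am.
rewrite (@cf_lim a 0 v r)//; exists m.+1.*2 => // k /= mk.
by rewrite addn0 vE.
Qed.

End KappaConvergence.

(** * kappa conjugates L and is bijective above the irrationals *)

Section Kappa.
Local Open Scope classical_set_scope.
Local Open Scope ring_scope.
Context {R : realType}.
Implicit Types (x r s : R) (y z : Rhat R) (a b : nat -> bool) (w : boundary).

Lemma kappa_bits a : kappa R (bits a) = cf R (exponents a).
Proof.
by rewrite /kappa /= digit_wordK /digit_word /=; case: (a 0).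
Qed.

Lemma kappa_Sbits a : kappa R (Sbits a) = hatN (hatV (kappa R (bits a))).
Proof. by rewrite kappa_bits /kappa /= [digits _](digit_wordK a). Qed.

Lemma kappa_cons_bits d a :
  kappa R (bits (cons_seq d a)) = digit_map d (kappa R (bits a)).
Proof. by rewrite !kappa_bits cf_cons. Qed.

Lemma kappa_bits_ge0 a : hat_ge0 (kappa R (bits a)).
Proof. by rewrite kappa_bits cf_ge0. Qed.

Lemma hatV0 : hatV (Some 0 : Rhat R) = None.
Proof. by rewrite /hatV eqxx. Qed.

Local Arguments hatV {R} x : simpl never.

(** With y = kappa(a) in [0, oo], the values at Sa, 0a and 1a are -1/y, 1 + y and
    1/(1 + 1/y), which z |-> 1 - 1/z permutes cyclically.  The endpoints y = 0
    and y = oo are checked by hand. *)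
Lemma kappa_L w : kappa R (L_boundary w) = hat_sub 1 (hatV (kappa R w)).
Proof.
have [LS L0 L1] := L_boundaryE.
case: (boundary_headP w) => a; rewrite ?(LS, L0, L1) ?kappa_Sbits !kappa_cons_bits;
  move: (kappa_bits_ge0 a); case: (kappa R (bits a)) => [r|] /= r0.
- rewrite digit_map_some//; have [->|rn0] := eqVneq r 0.
    by rewrite hatV0 /= addr0 subr0.
  rewrite !hatV_some//= ?hatV_some ?oppr_eq0 ?invr_eq0//=.
  by rewrite invrN invrK opprK.
- by rewrite digit_map_none oppr0 hatV0.
- rewrite !digit_map_some// hatV_some ?gt_eqF ?ltr_pwDl//=; congr Some.
  by field; rewrite gt_eqF ?ltr_pwDl.
- by rewrite !digit_map_none /= subr0.
- rewrite digit_map_some//; have [->|rn0] := eqVneq r 0.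
    by rewrite mul0r hatV0.
  have r1 : 1 + r != 0 by rewrite gt_eqF ?ltr_pwDl.
  rewrite !hatV_some ?mulf_neq0 ?invr_eq0//=; congr Some.
  by field; rewrite r1.
- by rewrite digit_map_none hatV_some ?oner_eq0//= invr1 subrr oppr0.
Qed.

Lemma rationalD r s : rational r -> rational s -> rational (r + s).
Proof. by move=> [p _ <-] [q _ <-]; exists (p + q) => //; rewrite rmorphD. Qed.

Lemma rationalN r : rational r -> rational (- r).
Proof. by move=> [p _ <-]; exists (- p) => //; rewrite rmorphN. Qed.

Lemma rationalM r s : rational r -> rational s -> rational (r * s).
Proof. by move=> [p _ <-] [q _ <-]; exists (p * q) => //; rewrite rmorphM. Qed.

Lemma rationalV r : rational r -> rational r^-1.
Proof. by move=> [p _ <-]; exists p^-1 => //; rewrite fmorphV. Qed.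

Lemma rational1 : rational (1 : R).
Proof. by exists 1 => //; rewrite rmorph1. Qed.

Lemma rational0 : rational (0 : R).
Proof. by exists 0 => //; rewrite rmorph0. Qed.

Lemma irrational_neq r x : irrational x -> rational r -> x != r.
Proof. by move=> xI rQ; apply/eqP => xr; apply: xI; rewrite xr. Qed.

(** The slow continued fraction map: for x >= 0 it inverts the map of the digit
    1 if x < 1 and of the digit 0 otherwise. *)
Definition slow_cf x : R := if x < 1 then x / (1 - x) else x - 1.

Lemma digit_map_slow_cf x : 0 <= x -> digit_map (x < 1) (Some (slow_cf x)) = Some x.
Proof.
rewrite /slow_cf; case: ltP => x1 x0.
  have h : 0 < 1 - x by lra.
  rewrite digit_map_some; last by rewrite divr_ge0// ltW.
  congr Some.
  by field; rewrite !gt_eqF//; lra.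
by rewrite digit_map_some ?subr_ge0//; congr Some; lra.
Qed.

Lemma slow_cf_gt0 x : irrational x -> 0 < x -> 0 < slow_cf x.
Proof.
move=> xI x0; have := irrational_neq xI rational1; rewrite /slow_cf.
by case: (ltgtP x 1) => // x1 _; rewrite ?divr_gt0 ?subr_gt0.
Qed.

Lemma slow_cf_irrational x : irrational x -> irrational (slow_cf x).
Proof.
move=> xI; rewrite /slow_cf; case: ifP => x1 sQ; apply: xI.
  suff -> : x = (x / (1 - x)) / (1 + x / (1 - x)).
    by apply: rationalM => //; apply/rationalV/rationalD => //; exact: rational1.
  by field; rewrite !gt_eqF//; lra.
by rewrite -(subrK 1 x); apply: rationalD => //; exact: rational1.
Qed.

(** The images of [0, oo] under the two digit maps are [1, oo] and [0, 1], and an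
    irrational number lies in only one of them. *)
Lemma digit_map_inv d y x : irrational x -> hat_ge0 y ->
  digit_map d y = Some x -> d = (x < 1) /\ y = Some (slow_cf x).
Proof.
move=> xI; have x1 := irrational_neq xI rational1.
case: y => [r|] /= r0; last first.
  by rewrite digit_map_none; case: d => // -[x1E]; rewrite x1E eqxx in x1.
rewrite digit_map_some// => -[]; have h : 0 < 1 + r by lra.
case: d => xE.
  have xlt1 : x < 1 by rewrite -xE ltr_pdivrMr//; lra.
  rewrite /slow_cf xlt1; split=> //; congr Some; rewrite -xE.
  by field; rewrite !gt_eqF//; lra.
have xge1 : 1 <= x by lra.
by rewrite /slow_cf ltNge xge1; split=> //; congr Some; lra.
Qed.

Lemma kappa_digits a x n : irrational x -> kappa R (bits a) = Some x ->
  a n = (iter n slow_cf x < 1).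
Proof.
elim: n a x => [|n IHn] a x xI; rewrite -{1}(cons_tail a) kappa_cons_bits;
  move=> /(digit_map_inv xI (kappa_bits_ge0 _))[a0 ax] //.
rewrite iterSr -(IHn (tail_seq a))//; exact: slow_cf_irrational.
Qed.

Lemma kappa_bits_inj a b x : irrational x ->
  kappa R (bits a) = Some x -> kappa R (bits b) = Some x -> a = b.
Proof.
move=> xI ax bx; apply/funext => n.
by rewrite (kappa_digits n xI ax) (kappa_digits n xI bx).
Qed.

Lemma kappa_drop a n :
  kappa R (bits a) = digits_map a n (kappa R (bits (drop_seq n a))).
Proof.
elim: n => [//|n IHn]; rewrite IHn drop_seqE kappa_cons_bits //.
Qed.

(** The digits of x are forced to be those of its orbit under [slow_cf].  The
    number spelled by them and x itself then lie in the same intervals of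
    [digits_interval], of arbitrarily small length. *)
Lemma kappa_bits_surj x : irrational x -> 0 < x ->
  exists a, kappa R (bits a) = Some x.
Proof.
move=> xI x0; pose u n := iter n slow_cf x; pose a n := u n < 1.
exists a.
have uI n : irrational (u n) by elim: n => //= n; exact: slow_cf_irrational.
have u0 n : 0 < u n by elim: n => //= n; exact: slow_cf_gt0.
have ax n : digits_map a n (Some (u n)) = Some x.
  by elim: n => //= n IHn; rewrite -/(u n) digit_map_slow_cf ?ltW.
(* Without a digit 1, the orbit would decrease by 1 forever. *)
have [m am] : exists m, a m.
  apply: contrapT => a0; have ux n : u n = x - n%:R.
    elim: n => [|n IHn]; first by rewrite subr0.
    rewrite -natr1 /u /= -/(u n) /slow_cf.
    by case: ifP => [an|_]; [case: a0; exists n|rewrite IHn; lra].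
  have := u0 (Num.bound x); rewrite ux subr_gt0 ltNge => /negP; apply.
  by rewrite ltW// archi_boundP// ltW.
have [lo _ loP] := @digits_interval R _ _ _ (ltnSn m) am.
have [y + _] := loP _ (kappa_bits_ge0 (drop_seq m.+1 a)).
rewrite -kappa_drop => ay; rewrite ay; congr Some.
apply/eqP; rewrite -subr_eq0 -normr_eq0; apply/eqP/le_anti.
rewrite normr_ge0 andbT; apply/ler_addgt0Pr => e e0; rewrite add0r.
have [N _ /(_ N (leqnn N)) /= Ne] := near_infty_natSinv_lt (PosNum e0).
have mN : (m < m + N.+1)%N by rewrite addnS ltnS leq_addr.
have [lo' _ lo'P] := @digits_interval R _ _ _ mN am.
have [y' + /andP[h1 h2]] := lo'P _ (kappa_bits_ge0 (drop_seq (m + N.+1) a)).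
rewrite -kappa_drop ay => -[yE]; move: h1 h2; rewrite -{}yE => h1 h2.
have [x' + /andP[h3 h4]] := lo'P (Some (u (m + N.+1)%N)) (ltW (u0 _)).
rewrite ax => -[xE]; move: h3 h4; rewrite -{}xE => h3 h4.
rewrite addKn in h2 h4.
apply: le_trans (ltW Ne); move: (N.+1%:R^-1) h2 h4 => i h2 h4.
by rewrite ler_norml; lra.
Qed.

Lemma irrationalNV x : irrational x -> irrational (- x^-1).
Proof.
move=> xI xQ; apply: xI; rewrite -(invrK x) -(opprK x^-1).
exact/rationalV/rationalN.
Qed.

Lemma hatNV_inv y x : x != 0 -> hatN (hatV y) = Some x -> y = Some (- x^-1).
Proof.
move=> x0; case: y => [r|]; rewrite /hatV /=; last first.
  by rewrite oppr0 => -[x0E]; rewrite -x0E eqxx in x0.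
by case: eqP => //= _ [<-]; rewrite invrN opprK invrK.
Qed.

Lemma kappa_Sbits_eq a x : x != 0 ->
  kappa R (Sbits a) = Some x <-> kappa R (bits a) = Some (- x^-1).
Proof.
move=> x0; rewrite kappa_Sbits; split; first exact: hatNV_inv.
move=> ->; rewrite hatV_some ?oppr_eq0 ?invr_eq0//=.
by rewrite invrN opprK invrK.
Qed.

Lemma kappa_inj w w' x : irrational x ->
  kappa R w = Some x -> kappa R w' = Some x -> w = w'.
Proof.
move=> xI; have x0 := irrational_neq xI rational0.
(* A word a spells a number in [0, oo] and Sa one in [-oo, 0]. *)
have sgn a b : kappa R (bits a) = Some x ->
    kappa R (bits b) = Some (- x^-1) -> False.
  move=> ax bx; have := kappa_bits_ge0 a; have := kappa_bits_ge0 b.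
  rewrite ax bx /= oppr_ge0 invr_le0 => xle0 xge0.
  by move: x0; rewrite eq_le xle0 xge0.
case: (boundaryP w) => a; case: (boundaryP w') => b;
  rewrite ?kappa_Sbits_eq// => ax bx.
- by rewrite (kappa_bits_inj xI ax bx).
- by case: (sgn _ _ ax bx).
- by case: (sgn _ _ bx ax).
- by rewrite (kappa_bits_inj (irrationalNV xI) ax bx).
Qed.

Lemma kappa_surj x : irrational x -> exists w, kappa R w = Some x.
Proof.
move=> xI; have x0 := irrational_neq xI rational0.
case: (ltgtP 0 x) x0 => // x0 xn0.
  by have [a ax] := kappa_bits_surj xI x0; exists (bits a).
have [|a ax] := kappa_bits_surj (irrationalNV xI).
  by rewrite oppr_gt0 invr_lt0.
by exists (Sbits a); apply/kappa_Sbits_eq; rewrite ?lt_eqF.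
Qed.

Lemma JR_kappa w x : irrational x -> kappa R w = Some x ->
  JR x = kappa R (J_boundary w).
Proof.
move=> xI wx; rewrite /JR; congr (kappa R (J_boundary _)).
apply: (kappa_inj xI) => //.
by apply: (@getPex _ [set w | kappa R w = Some x]); exists w.
Qed.

End Kappa.

Theorem lemma11 (R : realType) :
  [/\ homeomorphism J_boundary,
      homeomorphism L_boundary,
      J_boundary \o L_boundary = L_boundary \o J_boundary
    & forall x : R, irrational x ->
        JR (1 - x^-1) = hat_sub 1 (hatV (JR x)) ].
Proof.
split; [exact: J_homeomorphism|exact: L_homeomorphism| |].
  by apply/funext => w; exact: J_L_commute.
move=> x xI; have [w wx] := kappa_surj xI.
have x0 := irrational_neq xI rational0.
have Lwx : kappa R (L_boundary w) = Some (1 - x^-1).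
  by rewrite kappa_L wx hatV_some.
have yI : irrational (1 - x^-1).
  move=> yQ; apply: (irrationalNV xI); rewrite -[- _](addKr 1).
  by apply: rationalD => //; exact/rationalN/rational1.
by rewrite (JR_kappa yI Lwx) J_L_commute kappa_L -(JR_kappa xI wx).
Qed.
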